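(* Let $\phi:R\rightarrow S$ be a finite type ring map of commutative rings. Then the following conditions are equivalent. (i) $\phi$ is an epimorphism of rings. (ii) $\phi^{\ast}:\operatorname{Spec}(S)\rightarrow\operatorname{Spec}(R)$ is universally injective and $\Omega_{S/R}=0$. (iii) $\phi$ is formally unramified and, for any field $K$ and any ring maps $f,g:S\rightarrow K$, if $f\circ\phi=g\circ\phi$ then $f=g$. (iv) $\phi^{\ast}$ is injective, $\Omega_{S/R}=0$, and for each prime ideal $\mathfrak{q}$ of $S$ the field extension $\kappa(\mathfrak{p})\subseteq\kappa(\mathfrak{q})$ is purely inseparable, where $\mathfrak{p}=\phi^{\ast}(\mathfrak{q})$.
   Context: All rings are commutative (with unit). An epimorphism of rings means an epimorphism in the category of commutative rings. A ring map $\phi:R\to S$ is of finite type if $S$ is finitely generated as an $R$-algebra via $\phi$. The map $\phi^{\ast}$ is $\mathfrak{q}\mapsto\phi^{-1}(\mathfrak{q})$. The map $\phi^{\ast}$ is said to be universally injective if for every ring map $R\rightarrow R'$ the map $\psi^{\ast}:\operatorname{Spec}(R'\otimes_{R}S)\rightarrow\operatorname{Spec}(R')$ is injective, where $\psi:R'\rightarrow R'\otimes_{R}S$, $r'\mapsto r'\otimes 1$, is the base change map. $\Omega_{S/R}$ is the module of Kähler differentials of $S$ over $R$ (via $\phi$). $\phi$ is formally unramified if for every $R$-algebra $A$ and every ideal $I$ of $A$ with $I^2=0$, any two $R$-algebra maps $S\to A$ with the same composite to $A/I$ are equal. $\kappa(\mathfrak{p})$ and $\kappa(\mathfrak{q})$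 denote the residue fields of $R$ at $\mathfrak{p}$ and of $S$ at $\mathfrak{q}$, and the extension $\kappa(\mathfrak{p})\subseteq\kappa(\mathfrak{q})$ is the one induced by $\phi$. A purely inseparable extension may be trivial; in characteristic $0$ it means a trivial extension, and in characteristic $p>0$ it means that every element of the larger field has some $p^n$-th power ($n\ge 0$) in the smaller field. *)

(* Defs.v *)
From HB Require Import structures.
From mathcomp Require Import all_boot all_algebra generic_quotient ring_quotient.
From mathcomp Require Import boolp.

Set Implicit Arguments.
Unset Strict Implicit.
Unset Printing Implicit Defensive.

Import GRing.Theory.
Local Open Scope ring_scope.
Local Open Scope quotient_scope.

(* Rings are [comPzRingType]s, so that the zero ring is a ring; an R-algebra
   is a ring together with a ring morphism from R. *)

(* The ideals and ideal quotients of [ring_quotient] are restricted to proper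
   ideals of nonzero rings; only its additive quotients are reused here. *)
Record ideal (A : comPzRingType) := Ideal {
  ideal_set :> A -> Prop;
  ideal_zero : ideal_set 0;
  ideal_add : forall x y, ideal_set x -> ideal_set y -> ideal_set (x + y);
  ideal_mul : forall a x, ideal_set x -> ideal_set (a * x) }.

Section QuotientRing.
Variables (A : comPzRingType) (I : ideal A).

Definition ideal_pred : {pred A} := fun x => `[< I x >].

Lemma ideal_predE x : (x \in ideal_pred) = `[< I x >]. Proof. by []. Qed.

Lemma ideal_pred_zmod : zmod_closed ideal_pred.
Proof.
split=> [|x y]; rewrite !ideal_predE; first exact/asboolP/ideal_zero.
move=> /asboolP Ix /asboolP Iy; apply/asboolP/ideal_add => //.
by rewrite -mulN1r; apply: ideal_mul.
Qed.
HB.instance Definition _ := GRing.isZmodClosed.Build A ideal_pred ideal_pred_zmod.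

Definition quotient_ring : Type := Quotient.quot ideal_pred.
HB.instance Definition _ := GRing.Zmodule.on quotient_ring.

Definition quotient_proj (x : A) : quotient_ring :=
  \pi_(Quotient.quot ideal_pred) x.

Lemma quotient_projP x y : quotient_proj x = quotient_proj y <-> I (x - y).
Proof.
rewrite /quotient_proj; split=> [e|Ixy].
  by apply/asboolP; rewrite -ideal_predE Quotient.idealrBE; apply/eqP.
by apply/eqP; rewrite -Quotient.idealrBE ideal_predE; apply/asboolP.
Qed.

Lemma quotient_proj_zmod : zmod_morphism quotient_proj.
Proof. by move=> x y; rewrite /quotient_proj raddfB. Qed.

Lemma quotient_reprK (x : quotient_ring) : quotient_proj (repr x) = x.
Proof. exact: reprK. Qed.

Definition quotient_one : quotient_ring := quotient_proj 1.
Definition quotient_mul (x y : quotient_ring) : quotient_ring :=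
  quotient_proj (repr x * repr y).

Lemma quotient_projM : {morph quotient_proj : x y / x * y >-> quotient_mul x y}.
Proof.
move=> x y; apply/quotient_projP.
have hx : I (x - repr (quotient_proj x)).
  by apply/quotient_projP; rewrite quotient_reprK.
have hy : I (y - repr (quotient_proj y)).
  by apply/quotient_projP; rewrite quotient_reprK.
set x' := repr _ in hx *; set y' := repr _ in hy *.
have -> : x * y - x' * y' = y * (x - x') + x' * (y - y').
  by rewrite !mulrBr [y * x]mulrC [y * x']mulrC addrA subrK.
by apply: ideal_add; apply: ideal_mul.
Qed.

Lemma quotientW (P : quotient_ring -> Prop) :
  (forall x, P (quotient_proj x)) -> forall x, P x.
Proof. by move=> h x; rewrite -(quotient_reprK x). Qed.

Lemma quotient_mulA : associative quotient_mul.
Proof.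
by elim/quotientW=> x; elim/quotientW=> y; elim/quotientW=> z;
  rewrite -!quotient_projM mulrA.
Qed.
Lemma quotient_mulC : commutative quotient_mul.
Proof.
by elim/quotientW=> x; elim/quotientW=> y; rewrite -!quotient_projM mulrC.
Qed.
Lemma quotient_mul1 : left_id quotient_one quotient_mul.
Proof. by elim/quotientW=> x; rewrite -quotient_projM mul1r. Qed.
Lemma quotient_projD : {morph quotient_proj : x y / x + y}.
Proof. by move=> x y; rewrite /quotient_proj raddfD. Qed.
Lemma quotient_mulDl : left_distributive quotient_mul +%R.
Proof.
elim/quotientW=> x; elim/quotientW=> y; elim/quotientW=> z.
by rewrite -quotient_projD -!quotient_projM -quotient_projD mulrDl.
Qed.
HB.instance Definition _ := GRing.Zmodule_isComPzRing.Build quotient_ring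
  quotient_mulA quotient_mulC quotient_mul1 quotient_mulDl.

HB.instance Definition _ := GRing.isZmodMorphism.Build A quotient_ring
  quotient_proj quotient_proj_zmod.
Lemma quotient_proj_monoid : monoid_morphism quotient_proj.
Proof. by split=> // x y; rewrite quotient_projM. Qed.
HB.instance Definition _ := GRing.isMonoidMorphism.Build A quotient_ring
  quotient_proj quotient_proj_monoid.

End QuotientRing.

Record Spec (A : comPzRingType) := PrimeIdeal {
  prime_ideal :> ideal A;
  prime_proper : ~ prime_ideal 1;
  prime_mul : forall x y,
    prime_ideal (x * y) -> prime_ideal x \/ prime_ideal y }.

Section SpecMap.
Variables (A B : comPzRingType) (f : {rmorphism A -> B}) (q : Spec B).

Definition preideal : ideal A.
Proof.
refine (@Ideal A (fun x => q (f x)) _ _ _) => [|x y|a x] /=.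
- by rewrite rmorph0; apply: ideal_zero.
- by rewrite rmorphD; apply: ideal_add.
- by rewrite rmorphM; apply: ideal_mul.
Defined.

Definition spec_map : Spec A.
Proof.
refine (@PrimeIdeal A preideal _ _) => [|x y] /=.
- by rewrite rmorph1; apply: prime_proper.
- by rewrite rmorphM; apply: prime_mul.
Defined.

End SpecMap.

(* The residue field at [p] is the fraction field of the domain [A / p]. *)
Section ResidueField.
Variables (A : comPzRingType) (p : Spec A).

Definition residue_domain : Type := quotient_ring p.
HB.instance Definition _ := GRing.ComPzRing.on residue_domain.

Lemma residue_domain_oner_neq0 : 1 != 0 :> residue_domain.
Proof.
apply/eqP => e; apply: (@prime_proper A p).
rewrite -[1]subr0; apply/quotient_projP.
by rewrite [RHS]rmorph0 [LHS]rmorph1.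
Qed.
HB.instance Definition _ := GRing.PzSemiRing_isNonZero.Build residue_domain
  residue_domain_oner_neq0.

Definition residue_domain_unit : pred residue_domain :=
  fun x => `[< exists y, y * x = 1 >].
Definition residue_domain_inv (x : residue_domain) : residue_domain :=
  if pselect (exists y, y * x = 1) is left h then projT1 (cid h) else x.

Lemma residue_domain_mulV :
  {in residue_domain_unit, left_inverse 1 residue_domain_inv *%R}.
Proof.
move=> x /asboolP ux; rewrite /residue_domain_inv.
by case: pselect => // h; case: cid.
Qed.
Lemma residue_domain_unitP (x y : residue_domain) :
  y * x = 1 -> residue_domain_unit x.
Proof. by move=> yx; apply/asboolP; exists y. Qed.
Lemma residue_domain_inv_out :
  {in [predC residue_domain_unit], residue_domain_inv =1 id}.
Proof.
move=> x; rewrite inE => /asboolP ux; rewrite /residue_domain_inv.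
by case: pselect.
Qed.
HB.instance Definition _ := GRing.ComNzRing_hasMulInverse.Build residue_domain
  residue_domain_mulV residue_domain_unitP residue_domain_inv_out.

Lemma residue_domain_idomain : GRing.integral_domain_axiom residue_domain.
Proof.
have zP z : quotient_proj p z = 0 <-> p z.
  by rewrite -[X in _ = X](rmorph0 (quotient_proj p)) quotient_projP subr0.
elim/quotientW => x; elim/quotientW => y.
rewrite -[_ * _](rmorphM (quotient_proj p)) => /zP /prime_mul[] /zP e.
  by apply/orP; left; apply/eqP.
by apply/orP; right; apply/eqP.
Qed.
HB.instance Definition _ := GRing.ComUnitRing_isIntegral.Build residue_domain
  residue_domain_idomain.

Definition residue_field : fieldType := {fraction residue_domain}.

End ResidueField.

Section FractionMap.
Variables (D E : idomainType) (f : {rmorphism D -> E}) (f_inj : injective f).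

Local Notation "x %:F" := (FracField.tofrac x).

(* Well defined because an injective [f] sends denominators to denominators. *)
Definition fraction_map of injective f := fun x : {fraction D} =>
  (f (repr x).1)%:F / (f (repr x).2)%:F : {fraction E}.

Lemma fractionE (K : idomainType) (x : {fraction K}) :
  x = (repr x).1%:F / (repr x).2%:F.
Proof.
have d0 : (repr x).2%:F != 0 by rewrite tofrac_eq0 denom_ratioP.
apply: (mulIf d0); rewrite divfK // -{1}[x]reprK.
have tofracE a : a%:F = \pi_({fraction K}) (Ratio a 1).
  by rewrite /FracField.tofrac; unlock.
rewrite !tofracE -[LHS]FracField.pi_mul.
apply/eqmodP; rewrite /= FracField.equivfE /FracField.mulf.
by rewrite !numden_Ratio ?mulf_neq0 ?oner_eq0 ?denom_ratioP // !mulr1 mulrC.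
Qed.

Lemma tofrac_inj_neq0 d : d != 0 -> (f d)%:F != 0.
Proof. by rewrite tofrac_eq0 -(inj_eq f_inj) rmorph0. Qed.

Lemma fraction_mapE n d : d != 0 ->
  fraction_map f_inj (n%:F / d%:F) = (f n)%:F / (f d)%:F.
Proof.
move=> d0; rewrite /fraction_map; set x := n%:F / d%:F.
have r0 := denom_ratioP (repr x).
apply/eqP; rewrite eqr_div ?tofrac_inj_neq0 // -!rmorphM tofrac_eq.
rewrite (inj_eq f_inj) -tofrac_eq !rmorphM -eqr_div ?tofrac_eq0 //.
by rewrite -fractionE.
Qed.

Lemma fraction_map_zmod : zmod_morphism (fraction_map f_inj).
Proof.
move=> x y; rewrite [x]fractionE [y]fractionE.
set a := (repr x).1; set b := (repr x).2.
set c := (repr y).1; set d := (repr y).2.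
have b0 : b != 0 by apply: denom_ratioP.
have d0 : d != 0 by apply: denom_ratioP.
have -> : a%:F / b%:F - c%:F / d%:F = (a * d - c * b)%:F / (b * d)%:F.
  by rewrite -mulNr addf_div ?tofrac_eq0 // rmorphB !rmorphM mulNr.
rewrite !fraction_mapE ?mulf_neq0 // -[in RHS]mulNr addf_div ?tofrac_inj_neq0 //.
by rewrite !(rmorphB, rmorphM) mulNr.
Qed.
HB.instance Definition _ := GRing.isZmodMorphism.Build {fraction D} {fraction E}
  (fraction_map f_inj) fraction_map_zmod.

Lemma fraction_map_monoid : monoid_morphism (fraction_map f_inj).
Proof.
split=> [|x y].
  have := @fraction_mapE 1 1 (oner_neq0 _).
  by rewrite !rmorph1 !divr1.
rewrite [x]fractionE [y]fractionE.
set a := (repr x).1; set b := (repr x).2.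
set c := (repr y).1; set d := (repr y).2.
have b0 : b != 0 by apply: denom_ratioP.
have d0 : d != 0 by apply: denom_ratioP.
rewrite mulf_div -!rmorphM !fraction_mapE ?mulf_neq0 //.
by rewrite mulf_div -!rmorphM.
Qed.
HB.instance Definition _ := GRing.isMonoidMorphism.Build {fraction D} {fraction E}
  (fraction_map f_inj) fraction_map_monoid.

End FractionMap.

Section ResidueMap.
Variables (A B : comPzRingType) (f : {rmorphism A -> B}) (q : Spec B).

Definition residue_domain_map
    (x : residue_domain (spec_map f q)) : residue_domain q :=
  quotient_proj q (f (repr x)).

Lemma residue_domain_mapE a :
  residue_domain_map (quotient_proj (spec_map f q) a) = quotient_proj q (f a).
Proof.
apply/quotient_projP; rewrite -rmorphB.
by apply/(quotient_projP (spec_map f q)); rewrite quotient_reprK.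
Qed.

Lemma residue_domain_map_zmod : zmod_morphism residue_domain_map.
Proof.
elim/quotientW => x; elim/quotientW => y.
by rewrite -[_ - _]rmorphB !residue_domain_mapE !rmorphB.
Qed.
HB.instance Definition _ := GRing.isZmodMorphism.Build
  (residue_domain (spec_map f q)) (residue_domain q)
  residue_domain_map residue_domain_map_zmod.

Lemma residue_domain_map_monoid : monoid_morphism residue_domain_map.
Proof.
split=> [|].
  rewrite -[X in residue_domain_map X](rmorph1 (quotient_proj (spec_map f q))).
  by rewrite residue_domain_mapE !rmorph1.
elim/quotientW => x; elim/quotientW => y.
by rewrite -[_ * _](rmorphM (quotient_proj (spec_map f q)))
  !residue_domain_mapE !rmorphM.
Qed.
HB.instance Definition _ := GRing.isMonoidMorphism.Build
  (residue_domain (spec_map f q)) (residue_domain q)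
  residue_domain_map residue_domain_map_monoid.

Lemma residue_domain_map_inj : injective residue_domain_map.
Proof.
elim/quotientW => x; elim/quotientW => y; rewrite !residue_domain_mapE.
by move=> /quotient_projP; rewrite -rmorphB => h; apply/quotient_projP.
Qed.

Definition residue_map :
    {rmorphism residue_field (spec_map f q) -> residue_field q} :=
  fraction_map residue_domain_map_inj.

End ResidueMap.

(* The extension [f : K -> L] is viewed through its image; trivial extensions
   are allowed, and are the only ones allowed in characteristic 0. *)
Definition purely_inseparable (K L : fieldType) (f : {rmorphism K -> L}) :=
  ([pchar K] =i pred0 -> forall y, exists x, f x = y) /\
  (forall p, p \in [pchar K] -> forall y, exists n x, f x = y ^+ (p ^ n)).

(* A list over [X] stands for the formal sum of its entries; [fsum rel] is the
   commutative monoid generated by [X] subject to the relations [rel]. *)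
Section FormalSums.
Variables (X : choiceType) (rel : seq X -> seq X -> Prop).

Inductive fsum_eq : seq X -> seq X -> Prop :=
| fsum_rel s t : rel s t -> fsum_eq s t
| fsum_refl s : fsum_eq s s
| fsum_sym s t : fsum_eq s t -> fsum_eq t s
| fsum_trans t s u : fsum_eq s t -> fsum_eq t u -> fsum_eq s u
| fsum_cat s s' t t' : fsum_eq s s' -> fsum_eq t t' -> fsum_eq (s ++ t) (s' ++ t')
| fsum_comm s t : fsum_eq (s ++ t) (t ++ s).

Definition fsum_eqb (s t : seq X) : bool := `[< fsum_eq s t >].

Lemma fsum_eqb_equiv : equiv_class_of fsum_eqb.
Proof.
split=> [s|s t|t s u].
- exact/asboolP/fsum_refl.
- by apply/asboolP/asboolP; apply: fsum_sym.
- by move=> /asboolP st /asboolP tu; apply/asboolP/(fsum_trans st tu).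
Qed.
Canonical fsum_equiv := EquivRelPack fsum_eqb_equiv.

Definition fsum : Type := {eq_quot fsum_equiv}.
HB.instance Definition _ := Choice.on fsum.

Definition fsum_class (s : seq X) : fsum := \pi_({eq_quot fsum_equiv}) s.

Lemma fsum_classP s t : fsum_class s = fsum_class t <-> fsum_eq s t.
Proof. by split=> [/eqmodP /asboolP | st]; last exact/eqmodP/asboolP. Qed.

Lemma fsum_reprK (x : fsum) : fsum_class (repr x) = x.
Proof. exact: reprK. Qed.

Lemma fsum_repr s : fsum_eq (repr (fsum_class s)) s.
Proof. by apply/fsum_classP; rewrite fsum_reprK. Qed.

Lemma fsumW (P : fsum -> Prop) : (forall s, P (fsum_class s)) -> forall x, P x.
Proof. by move=> h x; rewrite -(fsum_reprK x). Qed.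

Definition fsum_zero : fsum := fsum_class [::].
Definition fsum_add (x y : fsum) : fsum := fsum_class (repr x ++ repr y).

Lemma fsum_addE s t :
  fsum_add (fsum_class s) (fsum_class t) = fsum_class (s ++ t).
Proof. by apply/fsum_classP/fsum_cat; apply: fsum_repr. Qed.

Lemma fsum_addA : associative fsum_add.
Proof.
by elim/fsumW=> x; elim/fsumW=> y; elim/fsumW=> z; rewrite !fsum_addE catA.
Qed.
Lemma fsum_addC : commutative fsum_add.
Proof.
by elim/fsumW=> x; elim/fsumW=> y; rewrite !fsum_addE; apply/fsum_classP/fsum_comm.
Qed.
Lemma fsum_add0 : left_id fsum_zero fsum_add.
Proof. by elim/fsumW=> x; rewrite fsum_addE. Qed.
HB.instance Definition _ := GRing.isNmodule.Build fsum
  fsum_addA fsum_addC fsum_add0.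

Lemma fsum_class_cat s t : fsum_class (s ++ t) = fsum_class s + fsum_class t.
Proof. exact: esym (fsum_addE _ _). Qed.

(* Functions on lists compatible with the relations descend to [fsum]. *)
Section Lift.
Variables (M : nmodType) (h : X -> M).
Definition fsum_eval (s : seq X) : M := \sum_(x <- s) h x.
Hypothesis h_rel : forall s t, rel s t -> fsum_eval s = fsum_eval t.
Lemma fsum_eval_eq s t : fsum_eq s t -> fsum_eval s = fsum_eval t.
Proof.
elim=> {s t} [s t|s|s t _ ->|t s u _ -> _ ->|s s' t t' _ es _ et|s t] //.
- exact: h_rel.
- by rewrite /fsum_eval !big_cat /= -!/(fsum_eval _) es et.
- by rewrite /fsum_eval !big_cat /= addrC.
Qed.
Definition fsum_lift (x : fsum) : M := fsum_eval (repr x).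
Lemma fsum_liftE s : fsum_lift (fsum_class s) = fsum_eval s.
Proof. exact/fsum_eval_eq/fsum_repr. Qed.
Lemma fsum_liftD : {morph fsum_lift : x y / x + y}.
Proof.
elim/fsumW=> s; elim/fsumW=> t.
by rewrite -fsum_class_cat !fsum_liftE /fsum_eval big_cat.
Qed.
Lemma fsum_lift0 : fsum_lift 0 = 0.
Proof. by rewrite [LHS](fsum_liftE [::]) /fsum_eval big_nil. Qed.
End Lift.

End FormalSums.

Section Tensor.
Variables (R A B : comPzRingType).
Variables (f : {rmorphism R -> A}) (g : {rmorphism R -> B}).

(* The pair [(a, b)] stands for the pure tensor of [a] and [b]. *)
Inductive tensor_rel : seq (A * B) -> seq (A * B) -> Prop :=
| tensor_rel_addl a a' b : tensor_rel [:: (a + a', b)] [:: (a, b); (a', b)]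
| tensor_rel_addr a b b' : tensor_rel [:: (a, b + b')] [:: (a, b); (a, b')]
| tensor_rel_0l b : tensor_rel [:: (0, b)] [::]
| tensor_rel_0r a : tensor_rel [:: (a, 0)] [::]
| tensor_rel_scale r a b : tensor_rel [:: (f r * a, b)] [:: (a, g r * b)].

Definition tensor : Type := fsum tensor_rel.
HB.instance Definition _ := GRing.Nmodule.on tensor.

Definition pure_tensor (a : A) (b : B) : tensor :=
  fsum_class tensor_rel [:: (a, b)].
Local Notation "a ⊗ b" := (pure_tensor a b) (at level 35).

Lemma pure_tensorDl a a' b : (a + a') ⊗ b = a ⊗ b + a' ⊗ b.
Proof.
by rewrite -fsum_class_cat; apply/fsum_classP/fsum_rel/tensor_rel_addl.
Qed.
Lemma pure_tensorDr a b b' : a ⊗ (b + b') = a ⊗ b + a ⊗ b'.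
Proof.
by rewrite -fsum_class_cat; apply/fsum_classP/fsum_rel/tensor_rel_addr.
Qed.
Lemma pure_tensor0l b : 0 ⊗ b = 0.
Proof. exact/fsum_classP/fsum_rel/tensor_rel_0l. Qed.
Lemma pure_tensor0r a : a ⊗ 0 = 0.
Proof. exact/fsum_classP/fsum_rel/tensor_rel_0r. Qed.
Lemma pure_tensorZ r a b : (f r * a) ⊗ b = a ⊗ (g r * b).
Proof. exact/fsum_classP/fsum_rel/tensor_rel_scale. Qed.

Definition balanced (M : nmodType) (h : A -> B -> M) :=
  [/\ forall b, {morph h^~ b : x y / x + y >-> x + y},
      forall a, {morph h a : x y / x + y >-> x + y},
      forall b, h 0 b = 0, forall a, h a 0 = 0
    & forall r a b, h (f r * a) b = h a (g r * b)].

Definition tensor_lift (M : nmodType) (h : A -> B -> M) (x : tensor) : M :=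
  fsum_lift (fun ab => h ab.1 ab.2) x.

Section TensorLift.
Variables (M : nmodType) (h : A -> B -> M) (hP : balanced h).
Lemma tensor_lift_rel s t : tensor_rel s t ->
  fsum_eval (fun ab => h ab.1 ab.2) s = fsum_eval (fun ab => h ab.1 ab.2) t.
Proof.
case: hP => hDl hDr h0l h0r hZ.
by rewrite /fsum_eval; case=> *; rewrite !(big_cons, big_nil) /= ?addr0;
  rewrite ?(hDl, hDr, h0l, h0r, hZ).
Qed.
Lemma tensor_liftD : {morph tensor_lift h : x y / x + y}.
Proof. exact: fsum_liftD tensor_lift_rel. Qed.
Lemma tensor_lift0 : tensor_lift h 0 = 0.
Proof. exact: fsum_lift0 tensor_lift_rel. Qed.
Lemma tensor_liftE a b : tensor_lift h (a ⊗ b) = h a b.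
Proof.
rewrite /tensor_lift (fsum_liftE tensor_lift_rel).
by rewrite /fsum_eval big_seq1.
Qed.
End TensorLift.

Lemma tensorW (P : tensor -> Prop) : P 0 ->
  (forall a b x, P x -> P (a ⊗ b + x)) -> forall x, P x.
Proof.
move=> P0 PD; elim/fsumW; elim=> [|[a b] s IHs]; first exact: P0.
by rewrite -cat1s fsum_class_cat; apply: PD.
Qed.

Definition tensor_opp : tensor -> tensor := tensor_lift (fun a b => (- a) ⊗ b).

Lemma tensor_opp_balanced : balanced (fun a b => (- a) ⊗ b).
Proof.
split=> [b a a'|a b b'|b|a|r a b].
- by rewrite opprD pure_tensorDl.
- by rewrite pure_tensorDr.
- by rewrite oppr0 pure_tensor0l.
- by rewrite pure_tensor0r.
- by rewrite -mulrN pure_tensorZ.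
Qed.

Lemma tensor_addN : left_inverse 0 tensor_opp +%R.
Proof.
have bal := tensor_opp_balanced; rewrite /tensor_opp.
elim/tensorW=> [|a b x IHx]; first by rewrite (tensor_lift0 bal) addr0.
rewrite (tensor_liftD bal) (tensor_liftE bal) addrACA IHx addr0.
by rewrite -pure_tensorDl addNr pure_tensor0l.
Qed.
HB.instance Definition _ := GRing.Nmodule_isZmodule.Build tensor tensor_addN.

Definition tensor_mul1 (a : A) (b : B) : tensor -> tensor :=
  tensor_lift (fun c d => (a * c) ⊗ (b * d)).
Definition tensor_mul (x y : tensor) : tensor :=
  tensor_lift (fun a b => tensor_mul1 a b y) x.

Lemma tensor_mul1_balanced a b : balanced (fun c d => (a * c) ⊗ (b * d)).
Proof.
split=> [d c c'|c d d'|d|c|r c d].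
- by rewrite mulrDr pure_tensorDl.
- by rewrite mulrDr pure_tensorDr.
- by rewrite mulr0 pure_tensor0l.
- by rewrite mulr0 pure_tensor0r.
- by rewrite mulrCA pure_tensorZ mulrCA.
Qed.

Lemma tensor_mul1D a b : {morph tensor_mul1 a b : x y / x + y}.
Proof. exact: tensor_liftD (tensor_mul1_balanced a b). Qed.
Lemma tensor_mul10 a b : tensor_mul1 a b 0 = 0.
Proof. exact: tensor_lift0 (tensor_mul1_balanced a b). Qed.
Lemma tensor_mul1E a b c d : tensor_mul1 a b (c ⊗ d) = (a * c) ⊗ (b * d).
Proof. exact: tensor_liftE (tensor_mul1_balanced a b) _ _. Qed.

Lemma tensor_mul_balanced y : balanced (fun a b => tensor_mul1 a b y).
Proof.
split=> [b a a'|a b b'|b|a|r a b]; elim/tensorW: y => [|c d y IHy];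
  rewrite ?tensor_mul10 ?addr0 // !tensor_mul1D !tensor_mul1E IHy ?addr0.
- by rewrite mulrDl pure_tensorDl addrACA.
- by rewrite mulrDl pure_tensorDr addrACA.
- by rewrite mul0r pure_tensor0l.
- by rewrite mul0r pure_tensor0r.
- by rewrite -mulrA pure_tensorZ mulrA.
Qed.

Lemma tensor_mulDl : left_distributive tensor_mul +%R.
Proof. by move=> x y z; apply: tensor_liftD (tensor_mul_balanced z) _ _. Qed.
Lemma tensor_mul0 y : tensor_mul 0 y = 0.
Proof. exact: tensor_lift0 (tensor_mul_balanced y). Qed.
Lemma tensor_mulE a b y : tensor_mul (a ⊗ b) y = tensor_mul1 a b y.
Proof. exact: tensor_liftE (tensor_mul_balanced y) _ _. Qed.

Lemma tensor_mulDr : right_distributive tensor_mul +%R.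
Proof.
elim/tensorW=> [|a b x IHx] y z; first by rewrite !tensor_mul0 addr0.
by rewrite !tensor_mulDl IHx !tensor_mulE tensor_mul1D addrACA.
Qed.
Lemma tensor_mulr0 x : tensor_mul x 0 = 0.
Proof.
elim/tensorW: x => [|a b x IHx]; first exact: tensor_mul0.
by rewrite tensor_mulDl IHx tensor_mulE tensor_mul10 addr0.
Qed.

Lemma tensor_mulC : commutative tensor_mul.
Proof.
elim/tensorW=> [|a b x IHx] y; first by rewrite tensor_mul0 tensor_mulr0.
rewrite tensor_mulDl tensor_mulDr IHx; congr (_ + _).
elim/tensorW: y => [|c d y IHy]; first by rewrite tensor_mul0 tensor_mulr0.
rewrite tensor_mulDl tensor_mulDr IHy; congr (_ + _).
by rewrite !tensor_mulE !tensor_mul1E [c * a]mulrC [d * b]mulrC.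
Qed.

Lemma tensor_mulA : associative tensor_mul.
Proof.
elim/tensorW=> [|a b x IHx] y z; first by rewrite !tensor_mul0.
rewrite !tensor_mulDl IHx; congr (_ + _).
elim/tensorW: y z => [|c d y IHy] z; first by rewrite ?(tensor_mul0, tensor_mulr0).
rewrite !(tensor_mulDl, tensor_mulDr) IHy; congr (_ + _).
elim/tensorW: z => [|c' d' z IHz]; first by rewrite !tensor_mulr0.
rewrite !tensor_mulDr IHz; congr (_ + _).
by rewrite !(tensor_mulE, tensor_mul1E) !mulrA.
Qed.

Lemma tensor_mul1r : left_id (1 ⊗ 1) tensor_mul.
Proof.
elim/tensorW=> [|a b x IHx]; first exact: tensor_mulr0.
by rewrite tensor_mulDr IHx tensor_mulE tensor_mul1E !mul1r.
Qed.
HB.instance Definition _ := GRing.Zmodule_isComPzRing.Build tensor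
  tensor_mulA tensor_mulC tensor_mul1r tensor_mulDl.

Lemma pure_tensorM a b c d : (a ⊗ b) * (c ⊗ d) = (a * c) ⊗ (b * d).
Proof. by rewrite [LHS]tensor_mulE tensor_mul1E. Qed.

Definition tensor_inl (a : A) : tensor := a ⊗ 1.

Lemma tensor_inl_zmod : zmod_morphism tensor_inl.
Proof.
move=> x y; apply: (addIr (tensor_inl y)).
by rewrite subrK /tensor_inl -pure_tensorDl subrK.
Qed.
HB.instance Definition _ :=
  GRing.isZmodMorphism.Build A tensor tensor_inl tensor_inl_zmod.
Lemma tensor_inl_monoid : monoid_morphism tensor_inl.
Proof. by split=> // x y; rewrite /tensor_inl pure_tensorM mulr1. Qed.
HB.instance Definition _ :=
  GRing.isMonoidMorphism.Build A tensor tensor_inl tensor_inl_monoid.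

End Tensor.

Section Differentials.
Variables (R S : comPzRingType) (phi : {rmorphism R -> S}).

(* The pair [(a, b)] stands for the differential form [a db]. *)
Inductive kaehler_rel : seq (S * S) -> seq (S * S) -> Prop :=
| kaehler_rel_coefD a a' b : kaehler_rel [:: (a + a', b)] [:: (a, b); (a', b)]
| kaehler_rel_coef0 b : kaehler_rel [:: (0, b)] [::]
| kaehler_rel_add a b b' : kaehler_rel [:: (a, b + b')] [:: (a, b); (a, b')]
| kaehler_rel_leibniz a b b' :
    kaehler_rel [:: (a, b * b')] [:: (a * b, b'); (a * b', b)]
| kaehler_rel_const a r : kaehler_rel [:: (a, phi r)] [::].

Definition kaehler : Type := fsum kaehler_rel.
HB.instance Definition _ := GRing.Nmodule.on kaehler.

Definition kaehler_form (a b : S) : kaehler :=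
  fsum_class kaehler_rel [:: (a, b)].
Definition kaehler_d : S -> kaehler := kaehler_form 1.

Lemma kaehler_formDl a a' b :
  kaehler_form (a + a') b = kaehler_form a b + kaehler_form a' b.
Proof.
by rewrite -fsum_class_cat; apply/fsum_classP/fsum_rel/kaehler_rel_coefD.
Qed.
Lemma kaehler_form0l b : kaehler_form 0 b = 0.
Proof. exact/fsum_classP/fsum_rel/kaehler_rel_coef0. Qed.
Lemma kaehler_formDr a b b' :
  kaehler_form a (b + b') = kaehler_form a b + kaehler_form a b'.
Proof.
by rewrite -fsum_class_cat; apply/fsum_classP/fsum_rel/kaehler_rel_add.
Qed.
Lemma kaehler_formM a b b' :
  kaehler_form a (b * b') = kaehler_form (a * b) b' + kaehler_form (a * b') b.
Proof.
by rewrite -fsum_class_cat; apply/fsum_classP/fsum_rel/kaehler_rel_leibniz.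
Qed.
Lemma kaehler_form_const a r : kaehler_form a (phi r) = 0.
Proof. exact/fsum_classP/fsum_rel/kaehler_rel_const. Qed.

Definition kaehler_scale (c : S) (w : kaehler) : kaehler :=
  fsum_lift (fun ab => kaehler_form (c * ab.1) ab.2) w.

Lemma kaehler_scale_rel c s t : kaehler_rel s t ->
  fsum_eval (fun ab => kaehler_form (c * ab.1) ab.2) s =
  fsum_eval (fun ab => kaehler_form (c * ab.1) ab.2) t.
Proof.
rewrite /fsum_eval; case=> *; rewrite !(big_cons, big_nil) /= ?addr0.
- by rewrite mulrDr kaehler_formDl.
- by rewrite mulr0 kaehler_form0l.
- by rewrite kaehler_formDr.
- by rewrite kaehler_formM !mulrA.
- by rewrite kaehler_form_const.
Qed.

Lemma kaehler_scaleDr : right_distributive kaehler_scale +%R.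
Proof. by move=> c; apply: fsum_liftD (@kaehler_scale_rel c). Qed.
Lemma kaehler_scaler0 c : kaehler_scale c 0 = 0.
Proof. exact: fsum_lift0 (@kaehler_scale_rel c). Qed.
Lemma kaehler_scaleE c a b :
  kaehler_scale c (kaehler_form a b) = kaehler_form (c * a) b.
Proof.
by rewrite /kaehler_scale (fsum_liftE (@kaehler_scale_rel c)) /fsum_eval big_seq1.
Qed.

Lemma kaehlerW (P : kaehler -> Prop) : P 0 ->
  (forall a b w, P w -> P (kaehler_form a b + w)) -> forall w, P w.
Proof.
move=> P0 PD; elim/fsumW; elim=> [|[a b] s IHs]; first exact: P0.
by rewrite -cat1s fsum_class_cat; apply: PD.
Qed.

Lemma kaehler_addN : left_inverse 0 (kaehler_scale (-1)) +%R.
Proof.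
elim/kaehlerW=> [|a b w IHw]; first by rewrite kaehler_scaler0 addr0.
rewrite kaehler_scaleDr kaehler_scaleE addrACA IHw addr0.
by rewrite -kaehler_formDl mulN1r addNr kaehler_form0l.
Qed.
HB.instance Definition _ := GRing.Nmodule_isZmodule.Build kaehler kaehler_addN.

Lemma kaehler_scaleA a b w :
  kaehler_scale a (kaehler_scale b w) = kaehler_scale (a * b) w.
Proof.
elim/kaehlerW: w => [|c d w IHw]; first by rewrite !kaehler_scaler0.
by rewrite !kaehler_scaleDr IHw !kaehler_scaleE mulrA.
Qed.
Lemma kaehler_scale1 : left_id 1 kaehler_scale.
Proof.
elim/kaehlerW=> [|a b w IHw]; first exact: kaehler_scaler0.
by rewrite kaehler_scaleDr IHw kaehler_scaleE mul1r.
Qed.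
Lemma kaehler_scaleDl w : {morph kaehler_scale^~ w : a b / a + b}.
Proof.
move=> a b; elim/kaehlerW: w => [|c d w IHw].
  by rewrite !kaehler_scaler0 addr0.
by rewrite !kaehler_scaleDr IHw !kaehler_scaleE mulrDl kaehler_formDl addrACA.
Qed.
HB.instance Definition _ := GRing.Zmodule_isLmodule.Build S kaehler
  kaehler_scaleA kaehler_scale1 kaehler_scaleDr kaehler_scaleDl.

End Differentials.

Section Properties.
Variables (R S : comPzRingType) (phi : {rmorphism R -> S}).

Definition ring_epimorphism : Prop :=
  forall (T : comPzRingType) (u v : {rmorphism S -> T}),
    u \o phi =1 v \o phi -> u =1 v.

Definition generated_subalgebra (xs : seq S) (s : S) : Prop :=
  forall B : {pred S}, subring_closed B -> (forall r, phi r \in B) ->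
    {subset xs <= B} -> s \in B.

Definition finite_type : Prop :=
  exists xs : seq S, forall s, generated_subalgebra xs s.

Definition universally_injective : Prop :=
  forall (R' : comPzRingType) (h : {rmorphism R -> R'}),
    injective (spec_map (@tensor_inl R R' S h phi)).

Definition formally_unramified : Prop :=
  forall (A : comPzRingType) (alpha : {rmorphism R -> A}) (I : ideal A),
    (forall x y, I x -> I y -> x * y = 0) ->
  forall u v : {rmorphism S -> A}, u \o phi =1 alpha -> v \o phi =1 alpha ->
    quotient_proj I \o u =1 quotient_proj I \o v -> u =1 v.

End Properties.

(* Main.v *)
(* The implications go around the cycle (i), (ii), (iii), (iv), (i).
   For an epimorphism the elements [s ⊗ 1] and [1 ⊗ s] of the tensor square
   agree.  Mapping to differentials by [a ⊗ b |-> a db] kills [ds]; mapping to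
   the tensor product of two residue fields over a common subfield, and
   contracting one factor by a linear retraction, shows that the fibres of
   [phi^*] are singletons and that its residue field extensions are even
   trivial.
   Conversely, let [J] be the ideal of [S ⊗ S] generated by the elements
   [s ⊗ 1 - 1 ⊗ s]; it is finitely generated because [S] is of finite type.
   Unramifiedness, applied to [(S ⊗ S) / J^2], gives [J = J^2], and testing on
   fields gives that [J] lies in every prime, so [J = 0] by Nakayama. *)
From HB Require Import structures.
Require Import Defs.
From mathcomp Require Import all_boot all_algebra.
From mathcomp Require Import generic_quotient boolp.
From mathcomp Require classical_sets.
From mathcomp Require Import ring.

Set Implicit Arguments.
Unset Strict Implicit.
Unset Printing Implicit Defensive.

Import GRing.Theory.
Local Open Scope ring_scope.

(** * Maximal submodules, existence of primes, linear retractions *)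

(* With [C = B] this is a maximal ideal; with [C] a field it is a hyperplane
   complementing [C] in [B]. *)
Lemma maximal_submodule (C B : comPzRingType) (f : {rmorphism C -> B}) :
  1 <> 0 :> B ->
  exists M : B -> Prop,
    [/\ M 0, forall x y, M x -> M y -> M (x + y),
        forall c x, M x -> M (f c * x), ~ M 1
      & forall x, ~ M x -> exists c, M (1 - f c * x)].
Proof.
move=> one_neq0.
pose submodule_avoiding_1 (X : B -> Prop) :=
  [/\ forall x y, X x -> X y -> X (x + y), forall c x, X x -> X (f c * x) & ~ X 1].
have [|M [[MD MZ M1] Mmax]] := @classical_sets.Zorn_bigcup B submodule_avoiding_1.
  move=> F FP Ftot; split.
  - move=> x y [X FX Xx] [Y FY Yy].
    by case: (Ftot X Y FX FY) => XY; [exists Y|exists X] => //;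
      [case: (FP Y FY)|case: (FP X FX)] => XD _ _; apply: XD => //; apply: XY.
  - by move=> c x [X FX Xx]; exists X => //; case: (FP X FX) => _ XZ _; apply: XZ.
  - by move=> [X FX X1]; case: (FP X FX).
(* The class does not ask for 0, because the union of the empty chain is empty. An [M] without 0 is
   empty, hence strictly inside the zero submodule. *)
have M0 : M 0.
  apply: contrapT => nM0.
  apply: (Mmax (fun x => x = 0)).
    split=> [x Mx|sub]; last exact/nM0/sub.
    by case: nM0; rewrite -(mul0r x) -(rmorph0 f); apply: MZ.
  by split=> [x y -> ->|c x ->|/one_neq0 //]; rewrite ?addr0 ?mulr0.
exists M; split=> // x nMx.
suff [m [c [Mm e]]] : exists m c, M m /\ 1 = m + f c * x.
  by exists c; rewrite e addrK.
apply: contrapT => n1; apply: (Mmax (fun y => exists m c, M m /\ y = m + f c * x)).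
  split=> [m Mm|sub]; first by exists m, 0; rewrite rmorph0 mul0r addr0.
  by apply: nMx; apply: sub; exists 0, 1; rewrite rmorph1 mul1r add0r.
split=> //.
- move=> _ _ [m [c [Mm ->]]] [n [d [Mn ->]]]; exists (m + n), (c + d).
  by split; [apply: MD|rewrite rmorphD mulrDl addrACA].
- move=> d _ [m [c [Mm ->]]]; exists (f d * m), (d * c).
  by split; [apply: MZ|rewrite rmorphM mulrDr mulrA].
Qed.

Lemma Spec_nonempty (A : comPzRingType) : 1 <> 0 :> A -> exists q : Spec A, True.
Proof.
move=> /(maximal_submodule idfun)[M [M0 MD MZ M1 Mmax]].
unshelve eexists (@PrimeIdeal A (@Ideal A M M0 MD MZ) _ _) => // x y /= Mxy.
have [Mx|/Mmax[c Mc]] := pselect (M x); [by left|right].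
have -> : y = y * (1 - c * x) + c * (x * y) by ring.
by apply: MD; apply: MZ.
Qed.

Lemma quotient_proj_eq0 (A : comPzRingType) (I : ideal A) x :
  quotient_proj I x = 0 <-> I x.
Proof. by rewrite -[X in _ = X](rmorph0 (quotient_proj I)) quotient_projP subr0. Qed.

(** Otherwise [A / xA] is nonzero, and a prime of it pulls back to a prime containing [x]. *)
Lemma unit_avoiding_Spec (A : comPzRingType) (x : A) :
  (forall q : Spec A, ~ q x) -> exists y, y * x = 1.
Proof.
move=> nx; apply: contrapT => nu.
unshelve epose (I := @Ideal A (fun z => exists y, z = y * x) _ _ _).
- by exists 0; rewrite mul0r.
- by move=> _ _ [y ->] [z ->]; exists (y + z); rewrite mulrDl.
- by move=> a _ [y ->]; exists (a * y); rewrite mulrA.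
have [|q _] := @Spec_nonempty (quotient_ring I).
  rewrite -[1](rmorph1 (quotient_proj I)) quotient_proj_eq0 => -[y e].
  by apply: nu; exists y.
apply: (nx (spec_map (quotient_proj I) q)) => /=.
suff -> : quotient_proj I x = 0 by apply: ideal_zero.
by apply/quotient_proj_eq0; exists 1; rewrite mul1r.
Qed.

Lemma Spec_ext (A : comPzRingType) (p q : Spec A) : (forall x, p x <-> q x) -> p = q.
Proof.
case: p => [[p p0 pD pM] p1 pp]; case: q => [[q q0 qD qM] q1 qq] /= pq.
have e : p = q by apply/funext => x; apply/propext.
case: q / e q0 qD qM q1 qq {pq} => q0 qD qM.
rewrite (Prop_irrelevance q0 p0) (Prop_irrelevance qD pD) (Prop_irrelevance qM pM).
by move=> q1 qq; rewrite (Prop_irrelevance q1 p1) (Prop_irrelevance qq pp).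
Qed.

(** A hyperplane [M] complements the image of [k], and [l x] is the unique [c] with
    [M (x - h c)]. *)
Lemma linear_retraction (k L : fieldType) (h : {rmorphism k -> L}) :
  exists l : L -> k,
    [/\ {morph l : x y / x + y}, forall c x, l (h c * x) = c * l x & l 1 = 1].
Proof.
have [|M [M0 MD MZ M1 Mmax]] := maximal_submodule h.
  by move/eqP; rewrite oner_eq0.
have MN x : M x -> M (- x) by move/(MZ (- 1)); rewrite rmorphN1 mulN1r.
have /choice[l lP] x : exists c, M (x - h c).
  have [Mx|nMx] := pselect (M x); first by exists 0; rewrite rmorph0 subr0.
  have [c Mc] := Mmax x nMx.
  have [c0|c0] := eqVneq c 0.
    by case: M1; move: Mc; rewrite c0 rmorph0 mul0r subr0.
  exists c^-1; have -> : x - h c^-1 = - (h c^-1 * (1 - h c * x)).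
    by rewrite mulrBr mulr1 mulrA -rmorphM mulVf // rmorph1 mul1r opprB.
  by apply/MN/MZ.
have luniq x c : M (x - h c) -> l x = c.
  move=> Mc; apply/eqP; rewrite -subr_eq0; apply/negP => /negP d0.
  apply: M1; rewrite -(rmorph1 h) -(mulVf d0) rmorphM; apply: MZ.
  have -> : h (l x - c) = (x - h c) + - (x - h (l x)) by rewrite rmorphB; ring.
  by apply: MD => //; apply: MN.
exists l; split=> [x y|c x|]; apply: luniq.
- by rewrite rmorphD opprD addrACA; apply: MD.
- by rewrite rmorphM -mulrBr; apply: MZ.
- by rewrite rmorph1 subrr.
Qed.

(** * Residue fields and kernels of maps to fields *)

Section ResidueProjection.
Variables (A : comPzRingType) (q : Spec A).

Definition residue_proj (a : A) : residue_field q :=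
  FracField.tofrac (quotient_proj q a : residue_domain q).

Lemma residue_proj_zmod : zmod_morphism residue_proj.
Proof. by move=> x y; rewrite /residue_proj rmorphB tofracB. Qed.
HB.instance Definition _ :=
  GRing.isZmodMorphism.Build A (residue_field q) residue_proj residue_proj_zmod.
Lemma residue_proj_monoid : monoid_morphism residue_proj.
Proof.
split=> [|x y]; rewrite /residue_proj (rmorph1, rmorphM); first exact: tofrac1.
exact: tofracM.
Qed.
HB.instance Definition _ :=
  GRing.isMonoidMorphism.Build A (residue_field q) residue_proj residue_proj_monoid.

Lemma residue_proj_eq0 a : residue_proj a = 0 <-> q a.
Proof.
rewrite -quotient_proj_eq0; split=> [/eqP|e]; last by rewrite /residue_proj e tofrac0.
by rewrite tofrac_eq0 => /eqP.
Qed.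

Lemma residue_fieldP (x : residue_field q) :
  exists a b, residue_proj b != 0 /\ x = residue_proj a / residue_proj b.
Proof.
exists (repr (repr x).1), (repr (repr x).2).
rewrite /residue_proj !quotient_reprK; split; last exact: fractionE.
by rewrite tofrac_eq0 denom_ratioP.
Qed.

End ResidueProjection.

Lemma residue_mapE (A B : comPzRingType) (f : {rmorphism A -> B}) (q : Spec B) a :
  residue_map f q (residue_proj (spec_map f q) a) = residue_proj q (f a).
Proof.
rewrite -[residue_proj _ a]divr1 -tofrac1 [LHS]fraction_mapE ?oner_neq0 //.
by rewrite rmorph1 tofrac1 divr1 /= residue_domain_mapE.
Qed.

Section Kernel.
Variables (A : comPzRingType) (K : fieldType) (f : {rmorphism A -> K}).

Definition kernel_ideal : ideal A.
Proof.
refine (@Ideal A (fun x => f x = 0) _ _ _) => [|x y fx fy|a x fx].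
- exact: rmorph0.
- by rewrite rmorphD fx fy addr0.
- by rewrite rmorphM fx mulr0.
Defined.

Definition kernel_prime : Spec A.
Proof.
refine (@PrimeIdeal A kernel_ideal _ _) => [|x y] /=.
- by rewrite rmorph1; apply/eqP/oner_neq0.
- by move/eqP; rewrite rmorphM mulf_eq0 => /orP[] /eqP; [left|right].
Defined.

End Kernel.

(** * The tensor product as a pushout of rings *)

Section TensorPushout.
Variables (R A B : comPzRingType).
Variables (f : {rmorphism R -> A}) (g : {rmorphism R -> B}).

Definition tensor_inr (b : B) : tensor f g := pure_tensor f g 1 b.

Lemma tensor_inr_zmod : zmod_morphism tensor_inr.
Proof.
move=> x y; apply: (addIr (tensor_inr y)).
by rewrite subrK /tensor_inr -pure_tensorDr subrK.
Qed.
HB.instance Definition _ :=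
  GRing.isZmodMorphism.Build B (tensor f g) tensor_inr tensor_inr_zmod.
Lemma tensor_inr_monoid : monoid_morphism tensor_inr.
Proof. by split=> // x y; rewrite /tensor_inr pure_tensorM mulr1. Qed.
HB.instance Definition _ :=
  GRing.isMonoidMorphism.Build B (tensor f g) tensor_inr tensor_inr_monoid.

Lemma tensor_inl_inr r : tensor_inl f g (f r) = tensor_inr (g r).
Proof. by rewrite /tensor_inl -[f r]mulr1 pure_tensorZ mulr1. Qed.

Lemma pure_tensorE a b : pure_tensor f g a b = tensor_inl f g a * tensor_inr b.
Proof. by rewrite pure_tensorM mulr1 mul1r. Qed.

Lemma tensor_ext (T : comPzRingType) (u v : {rmorphism tensor f g -> T}) :
  (forall a, u (tensor_inl f g a) = v (tensor_inl f g a)) ->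
  (forall b, u (tensor_inr b) = v (tensor_inr b)) -> u =1 v.
Proof.
move=> ul ur; elim/tensorW => [|a b x IHx]; first by rewrite !rmorph0.
by rewrite !rmorphD IHx pure_tensorE !rmorphM ul ur.
Qed.

Section Copairing.
Variables (T : comPzRingType) (u : {rmorphism A -> T}) (v : {rmorphism B -> T}).
Hypothesis uv : u \o f =1 v \o g.

Definition tensor_copair of u \o f =1 v \o g : tensor f g -> T :=
  tensor_lift (fun a b => u a * v b).

Let bal : balanced f g (fun a b => u a * v b).
Proof.
split=> [b x y|a x y|b|a|r a b]; rewrite ?(rmorphD, rmorph0, rmorphM).
- exact: mulrDl.
- exact: mulrDr.
- exact: mul0r.
- exact: mulr0.
- by rewrite -[v (g r)]uv /= mulrAC mulrC mulrA mulrC.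
Qed.

Lemma tensor_copair_pure a b : tensor_copair uv (pure_tensor f g a b) = u a * v b.
Proof. exact: tensor_liftE. Qed.

Lemma tensor_copair_zmod : zmod_morphism (tensor_copair uv).
Proof.
move=> x y; apply: (addIr (tensor_copair uv y)).
by rewrite subrK -[LHS](tensor_liftD bal) subrK.
Qed.
HB.instance Definition _ := GRing.isZmodMorphism.Build (tensor f g) T
  (tensor_copair uv) tensor_copair_zmod.
Lemma tensor_copair_monoid : monoid_morphism (tensor_copair uv).
Proof.
split=> [|x y]; first by rewrite tensor_copair_pure !rmorph1 mulr1.
elim/tensorW: x => [|a b x IHx]; first by rewrite mul0r raddf0 mul0r.
rewrite mulrDl !(raddfD (tensor_copair uv)) /= IHx mulrDl; congr (_ + _).
elim/tensorW: y {IHx} => [|c d y IHy]; first by rewrite mulr0 raddf0 mulr0.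
rewrite mulrDr !(raddfD (tensor_copair uv)) /= IHy mulrDr; congr (_ + _).
by rewrite pure_tensorM !tensor_copair_pure !rmorphM mulrACA.
Qed.
HB.instance Definition _ := GRing.isMonoidMorphism.Build (tensor f g) T
  (tensor_copair uv) tensor_copair_monoid.

Lemma tensor_copair_inl a : tensor_copair uv (tensor_inl f g a) = u a.
Proof. by rewrite tensor_copair_pure rmorph1 mulr1. Qed.
Lemma tensor_copair_inr b : tensor_copair uv (tensor_inr b) = v b.
Proof. by rewrite tensor_copair_pure rmorph1 mul1r. Qed.

End Copairing.

End TensorPushout.

(** * Ideals with finitely many generators and Nakayama's lemma *)

Section IdealSpan.
Variables (A : comPzRingType) (n : nat) (t : 'I_n -> A).

Lemma ideal_sum (I : ideal A) (F : 'I_n -> A) : (forall i, I (F i)) -> I (\sum_i F i).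
Proof.
by move=> IF; apply: (big_ind I) => //; [apply: ideal_zero|apply: ideal_add].
Qed.

Definition unit_ideal : ideal A :=
  @Ideal A (fun=> True) I (fun _ _ _ _ => I) (fun _ _ _ => I).

(** The product of [J] with the ideal generated by [t]: [unit_ideal] gives that ideal itself, and
    taking it for [J] gives its square. *)
Definition span_ideal (J : ideal A) : ideal A.
Proof.
refine (@Ideal A (fun x => exists a : 'I_n -> A,
  (forall i, J (a i)) /\ x = \sum_i a i * t i) _ _ _).
- exists (fun=> 0); split=> [i|]; first exact: ideal_zero.
  by rewrite big1 // => i _; rewrite mul0r.
- move=> _ _ [a [Ja ->]] [b [Jb ->]]; exists (fun i => a i + b i).
  split=> [i|]; first exact: ideal_add.
  by rewrite -big_split; apply: eq_bigr => i _; rewrite mulrDl.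
- move=> c _ [a [Ja ->]]; exists (fun i => c * a i).
  split=> [i|]; first exact: ideal_mul.
  by rewrite mulr_sumr; apply: eq_bigr => i _; rewrite mulrA.
Defined.

Lemma span_ideal_gen i : span_ideal unit_ideal (t i).
Proof.
exists (fun j => (j == i)%:R); split=> //.
by rewrite (bigD1 i) //= eqxx mul1r big1 ?addr0 // => j /negbTE ->; rewrite mul0r.
Qed.

Lemma span_idealS (J I : ideal A) x : (forall i, I (t i)) -> span_ideal J x -> I x.
Proof. by move=> It [a [_ ->]]; apply: ideal_sum => i; apply: ideal_mul. Qed.

Lemma span_idealM (J : ideal A) x y :
  J x -> span_ideal unit_ideal y -> span_ideal J (x * y).
Proof.
move=> Jx [b [_ ->]]; exists (fun i => b i * x).
split=> [i|]; first exact: ideal_mul.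
by rewrite mulr_sumr; apply: eq_bigr => i _; rewrite mulrCA mulrA.
Qed.

(* Nakayama: [det (1 - a)] is a unit, being 1 in every residue field. *)
Lemma span_ideal_nakayama (J : ideal A) :
  (forall (q : Spec A) x, J x -> q x) -> (forall i, span_ideal J (t i)) ->
  forall i, t i = 0.
Proof.
move=> Jq /choice[a aP] i.
pose M : 'M[A]_n := \matrix_(i, j) a i j.
pose T : 'cV[A]_n := \col_i t i.
have MT : (1%:M - M) *m T = 0.
  rewrite mulmxBl mul1mx; apply/matrixP => j l; rewrite !mxE.
  case: (aP j) => _ {1}->; apply/eqP; rewrite subr_eq0; apply/eqP.
  by apply: eq_bigr => m _; rewrite !mxE.
have [|y yd] := @unit_avoiding_Spec A (\det (1%:M - M)).
  move=> q /residue_proj_eq0; rewrite -det_map_mx => /eqP.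
  suff -> : map_mx (residue_proj q) (1%:M - M) = 1%:M by rewrite det1 oner_eq0.
  apply/matrixP => j l; rewrite !mxE rmorphB rmorph_nat /=.
  suff -> : residue_proj q (a j l) = 0 by rewrite subr0.
  by apply/residue_proj_eq0/Jq; case: (aP j).
(* The adjugate turns [(1 - a) t = 0] into [det (1 - a) t = 0]. *)
have : \adj (1%:M - M) *m ((1%:M - M) *m T) = 0 by rewrite MT mulmx0.
rewrite mulmxA mul_adj_mx mul_scalar_mx => /matrixP/(_ i 0).
by rewrite !mxE => e; rewrite -[t i]mul1r -yd -mulrA e mulr0.
Qed.

End IdealSpan.

(** * Implications between the four conditions *)

Section Characterizations.
Variables (R S : comPzRingType) (phi : {rmorphism R -> S}).

Let field_monic := forall (K : fieldType) (f g : {rmorphism S -> K}),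
  f \o phi =1 g \o phi -> f =1 g.

Lemma kaehler_eq0_form :
  (forall a b, kaehler_form phi a b = 0) -> forall w : kaehler phi, w = 0.
Proof. by move=> h; elim/kaehlerW => // a b w ->; rewrite h addr0. Qed.

Lemma epi_kaehler_eq0 : ring_epimorphism phi -> forall w : kaehler phi, w = 0.
Proof.
move=> epi; apply: kaehler_eq0_form => a b.
have bal : balanced phi phi (kaehler_form phi).
  split=> [c x y|c x y|c|c|r x y].
  - exact: kaehler_formDl.
  - exact: kaehler_formDr.
  - exact: kaehler_form0l.
  - by rewrite -(rmorph0 phi) kaehler_form_const.
  - by rewrite kaehler_formM kaehler_form_const addr0 mulrC.
have lr : tensor_inl phi phi =1 tensor_inr phi phi.
  by apply: epi => r; apply: tensor_inl_inr.
(* Now [a ⊗ b] equals [(a * b) ⊗ 1], which maps to [ab d1 = 0]. *)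
rewrite -(tensor_liftE bal) pure_tensorE -lr -rmorphM /tensor_inl (tensor_liftE bal).
by rewrite -(rmorph1 phi) kaehler_form_const.
Qed.

(** The difference [u - v] is an [R]-derivation into the square-zero ideal [I], so it factors
    through the differentials. *)
Lemma kaehler_eq0_unramified :
  (forall w : kaehler phi, w = 0) -> formally_unramified phi.
Proof.
move=> Om A alpha I I2 u v ua va uv s.
have Iuv b : I (u b - v b) by apply/quotient_projP; apply: uv.
have sq x y : (u x - v x) * (u y - v y) = 0 by apply: I2.
pose h (ab : S * S) := u ab.1 * (u ab.2 - v ab.2).
have h_rel l m : kaehler_rel phi l m -> fsum_eval h l = fsum_eval h m.
  rewrite /fsum_eval /h; case=> [a a' b|b|a b b'|a b b'|a r];
    rewrite !(big_cons, big_nil) /= ?addr0 ?rmorphD ?rmorphM ?rmorph0.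
  - exact: mulrDl.
  - exact: mul0r.
  - by rewrite opprD addrACA mulrDr.
  - apply/eqP; rewrite -subr_eq0; apply/eqP.
    (* The defect in the Leibniz rule is a multiple of a product of two elements of [I]. *)
    transitivity (- u a * ((u b - v b) * (u b' - v b'))); first by ring.
    by rewrite sq mulr0.
  - by rewrite [u (phi r)]ua [v (phi r)]va subrr mulr0.
have : fsum_lift h (kaehler_form phi 1 s) = 0.
  by rewrite [kaehler_form _ _ _]Om (fsum_lift0 h_rel).
rewrite (fsum_liftE h_rel) /fsum_eval big_seq1 /h /= rmorph1 mul1r => /eqP.
by rewrite subr_eq0 => /eqP.
Qed.

(* In the tensor square over [k], the elements [g1 s] and [g2 s] coincide;
   contracting the left factor with a retraction [l] onto [k] leaves [g2 s]. *)
Lemma epi_scalar (k K1 K2 : fieldType) (j : {rmorphism R -> k})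
    (h1 : {rmorphism k -> K1}) (h2 : {rmorphism k -> K2})
    (g1 : {rmorphism S -> K1}) (g2 : {rmorphism S -> K2}) :
  ring_epimorphism phi -> g1 \o phi =1 h1 \o j -> g2 \o phi =1 h2 \o j ->
  exists l : K1 -> k, l 0 = 0 /\ forall s, g2 s = h2 (l (g1 s)).
Proof.
move=> epi e1 e2; have [l [lD lZ l1]] := linear_retraction h1.
have l0 : l 0 = 0 by have := lZ 0 0; rewrite rmorph0 !mul0r.
exists l; split=> // s.
have bal : balanced h1 h2 (fun a b => h2 (l a) * b).
  split=> [b x y|a x y|b|a|r a b].
  - by rewrite lD rmorphD mulrDl.
  - exact: mulrDr.
  - by rewrite l0 rmorph0 mul0r.
  - exact: mulr0.
  - by rewrite lZ rmorphM mulrAC mulrC.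
have : (tensor_inl h1 h2 \o g1) s = (tensor_inr h1 h2 \o g2) s.
  apply: epi => r /=; rewrite [g1 _]e1 [g2 _]e2; exact: tensor_inl_inr.
move=> /(congr1 (tensor_lift (fun a b => h2 (l a) * b))).
by rewrite !(tensor_liftE bal) l1 rmorph1 mul1r mulr1 => ->.
Qed.

(** Transporting along the equation lets two primes with equal images share one base field
    [κ(p)]. *)
Lemma residue_map_along (q : Spec S) (p : Spec R) : spec_map phi q = p ->
  exists h : {rmorphism residue_field p -> residue_field q},
    forall a, h (residue_proj p a) = residue_proj q (phi a).
Proof. by case: p /; exists (residue_map phi q) => a; rewrite residue_mapE. Qed.

(** Over the common [κ(p)], the value of [x] at [q1] determines its value at [q2] through a map
    fixing 0, so vanishing transfers. *)
Lemma epi_spec_inj : ring_epimorphism phi -> injective (spec_map phi).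
Proof.
move=> epi.
suff sub (q1 q2 : Spec S) x : spec_map phi q1 = spec_map phi q2 -> q1 x -> q2 x.
  by move=> q1 q2 e; apply: Spec_ext => x; split; apply: sub.
move=> /residue_map_along[h1 h1E].
have [h2 h2E] := residue_map_along (erefl (spec_map phi q2)).
have [||l [l0 lE]] := @epi_scalar _ _ _ (residue_proj (spec_map phi q2))
  h1 h2 (residue_proj q1) (residue_proj q2) epi; try by move=> r /=; rewrite ?h1E ?h2E.
by move=> /residue_proj_eq0 q1x; apply/residue_proj_eq0; rewrite lE /= q1x l0 rmorph0.
Qed.

(** With both fields equal to [κ(q)], [epi_scalar] puts numerators and denominators in the image of
    [κ(p)]. *)
Lemma epi_residue_map_surj (q : Spec S) y :
  ring_epimorphism phi -> exists x, residue_map phi q x = y.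
Proof.
move=> epi.
have [||l [_ lE]] := @epi_scalar _ _ _ (residue_proj (spec_map phi q))
  (residue_map phi q) (residue_map phi q) (residue_proj q) (residue_proj q) epi;
  try by move=> r /=; rewrite residue_mapE.
have [a [b [_ ->]]] := residue_fieldP y.
by exists (l (residue_proj q a) / l (residue_proj q b)); rewrite fmorph_div -!lE.
Qed.

Lemma epi_base_change (R' : comPzRingType) (h : {rmorphism R -> R'}) :
  ring_epimorphism phi -> ring_epimorphism (tensor_inl h phi).
Proof.
move=> epi T u v uv; apply: tensor_ext => // s.
apply: (epi T (u \o tensor_inr h phi) (v \o tensor_inr h phi)) => r /=.
by rewrite -tensor_inl_inr; apply: uv.
Qed.

(** The maps [K ⊗ S -> K] induced by [f] and [g] have kernels contracting to the same ideal of [K],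
    so the kernels coincide; [f s ⊗ 1 - 1 ⊗ s] lies in the first, hence in the second. *)
Lemma universally_injective_field_monic : universally_injective phi -> field_monic.
Proof.
move=> ui K f g fg s.
have [h hE] : exists h : {rmorphism R -> K}, h =1 f \o phi by exists (f \o phi).
have hf : idfun \o h =1 f \o phi by move=> r /=; rewrite hE.
have hg : idfun \o h =1 g \o phi by move=> r /=; rewrite hE fg.
have e : kernel_prime (tensor_copair hf) = kernel_prime (tensor_copair hg).
  apply: (ui K h); apply: Spec_ext => x /=.
  by rewrite (tensor_copair_inl hf) (tensor_copair_inl hg).
have : kernel_prime (tensor_copair hf) (tensor_inl h phi (f s) - tensor_inr h phi s).
  by rewrite /= rmorphB /= (tensor_copair_inl hf) (tensor_copair_inr hf) subrr.
rewrite e /= rmorphB /= (tensor_copair_inl hg) (tensor_copair_inr hg) => /eqP.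
by rewrite subr_eq0 => /eqP.
Qed.

(** Both maps have the same kernel [q], and modulo [q] some power of [s] comes from [κ(p)]. Hence
    [f s] and [g s] have equal [e]-th powers, for an [e] whose power map is injective on [K]. *)
Lemma purely_inseparable_field_monic :
  injective (spec_map phi) ->
  (forall q : Spec S, purely_inseparable (residue_map phi q)) ->
  field_monic.
Proof.
move=> inj pi K f g fg s; pose q := kernel_prime f.
have qg : kernel_prime g = q.
  by apply: inj; apply: Spec_ext => r /=; rewrite [f _]fg.
(* In characteristic 0 take [e = 1]; otherwise [e = p ^ n], an iterate of the injective
   Frobenius. *)
have [e [x [eK xE]]] : exists e x, injective (fun z : K => z ^+ e) /\
    residue_map phi q x = residue_proj q s ^+ e.
  have [char0 charp] := pi q.
  have [[p pP]|nchar] :=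
    pselect (exists p, p \in [pchar residue_field (spec_map phi q)]).
    have [n [x xE]] := charp p pP (residue_proj q s).
    exists (p ^ n)%N, x; split=> //.
    (* The integer [p] lies in the prime under [q], which [f \o phi] kills. *)
    have pK : p \in [pchar K].
      rewrite inE (pcharf_prime pP) /= -(rmorph_nat f) -(rmorph_nat phi).
      have /residue_proj_eq0 -> // : residue_proj (spec_map phi q) p%:R = 0.
      by rewrite rmorph_nat (pcharf0 pP).
    elim: n {xE} => [|n IHn] a b; first by rewrite !expr1.
    rewrite expnSr !exprM -!(pFrobenius_autE pK) => /fmorph_inj; exact: IHn.
  have [|x xE] := char0 _ (residue_proj q s).
    by move=> p; apply/negbTE/negP => pP; apply: nchar; exists p.
  by exists 1, x; split=> //; rewrite expr1.
apply: eK; have [a [b [b0 ab]]] := residue_fieldP x.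
have fb0 : f (phi b) != 0.
  apply/eqP => fb; move/eqP: b0; apply; exact/residue_proj_eq0.
(* Clearing the denominator in [x = a / b] gives an element of [q], on which both [f] and [g]
   vanish. *)
have qab : q (phi b * s ^+ e - phi a).
  apply/residue_proj_eq0; rewrite rmorphB rmorphM rmorphXn -xE ab.
  rewrite fmorph_div !residue_mapE.
  rewrite mulrC divfK ?subrr // -residue_mapE fmorph_eq0 //.
have /= fab := qab; rewrite -qg /= in qab.
apply: (mulfI fb0); rewrite -!rmorphXn -rmorphM [f (phi b)]fg /= -rmorphM.
move/eqP: fab; rewrite rmorphB subr_eq0 => /eqP ->.
by move/eqP: qab; rewrite rmorphB subr_eq0 => /eqP ->; apply: fg.
Qed.

Lemma unramified_field_monic_epi : finite_type phi ->
  formally_unramified phi -> field_monic -> ring_epimorphism phi.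
Proof.
move=> [xs gen] unr mono T u v uv.
pose D s := tensor_inl phi phi s - tensor_inr phi phi s.
pose t (i : 'I_(size xs)) := D xs`_i.
pose J := span_ideal t (unit_ideal _).
(* By this twisted Leibniz rule the [s] with [D s] in [J] form a subalgebra, so membership need only
   be checked on the generators [xs]. *)
have DM s s' : D (s * s') = tensor_inl phi phi s * D s' + tensor_inr phi phi s' * D s.
  rewrite /D !rmorphM; ring.
have JD s : J (D s).
  apply/asboolP.
  apply: (gen s (fun s => `[< J (D s) >])) => [|r|_ /(nthP 0)[i ilt <-]].
  - split=> [|x y /asboolP Jx /asboolP Jy|x y /asboolP Jx /asboolP Jy]; apply/asboolP.
    + by rewrite /D !rmorph1 subrr; apply: ideal_zero.
    + have -> : D (x - y) = D x + -1 * D y by rewrite /D !rmorphB; ring.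
      by apply: ideal_add => //; apply: ideal_mul.
    + by rewrite DM; apply: ideal_add; apply: ideal_mul.
  - by apply/asboolP; rewrite /D tensor_inl_inr subrr; apply: ideal_zero.
  - exact/asboolP/(span_ideal_gen t (Ordinal ilt)).
have Jq (q : Spec (tensor phi phi)) x : J x -> q x.
  apply: span_idealS => i; apply/residue_proj_eq0; rewrite rmorphB; apply/eqP.
  rewrite subr_eq0; apply/eqP.
  apply: (mono _ (residue_proj q \o tensor_inl phi phi)
    (residue_proj q \o tensor_inr phi phi)).
  by move=> r /=; rewrite tensor_inl_inr.
(* [J2] is [J^2], and [I] below is the image of [J] in the quotient, of square zero. *)
pose J2 := span_ideal t J; pose proj : {rmorphism _ -> _} := quotient_proj J2.
unshelve epose (I := @Ideal (quotient_ring J2)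
  (fun y => exists x, J x /\ proj x = y) _ _ _).
- by exists 0; split; [apply: ideal_zero|rewrite rmorph0].
- move=> _ _ [x [Jx <-]] [y [Jy <-]]; exists (x + y).
  by split; [apply: ideal_add|rewrite rmorphD].
- elim/quotientW => a _ [x [Jx <-]]; exists (a * x).
  by split; [apply: ideal_mul|rewrite rmorphM].
have J2D s : J2 (D s).
  apply/quotient_proj_eq0; rewrite rmorphB; apply/eqP; rewrite subr_eq0; apply/eqP.
  apply: (unr _ (proj \o (tensor_inl phi phi \o phi)) I _
    (proj \o tensor_inl phi phi) (proj \o tensor_inr phi phi)) => //.
  - move=> _ _ [x [Jx <-]] [y [Jy <-]]; rewrite -rmorphM; apply/quotient_proj_eq0.
    exact: span_idealM.
  - by move=> r /=; rewrite tensor_inl_inr.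
  - by move=> r; apply/quotient_projP; exists (D r); split; [exact: JD|exact: rmorphB].
have t0 := span_ideal_nakayama Jq (fun i => J2D xs`_i).
(* The generators of [J] vanish, so [D s = 0]; the copairing of [u] and [v] sends [D s] to
   [u s - v s]. *)
move=> s; have [a [_ Ds]] := JD s.
move: Ds; rewrite big1 => [/(congr1 (tensor_copair uv))|i _]; last by rewrite t0 mulr0.
rewrite rmorphB raddf0 /= (tensor_copair_inl uv) (tensor_copair_inr uv) => /eqP.
by rewrite subr_eq0 => /eqP.
Qed.

End Characterizations.

Theorem theorem3p3 (R S : comPzRingType) (phi : {rmorphism R -> S})
    (phi_ft : finite_type phi) :
  [<-> ring_epimorphism phi;
       universally_injective phi /\ (forall w : kaehler phi, w = 0);
       formally_unramified phi /\
       (forall (K : fieldType) (f g : {rmorphism S -> K}),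
          f \o phi =1 g \o phi -> f =1 g);
       [/\ injective (spec_map phi), (forall w : kaehler phi, w = 0)
         & forall q : Spec S, purely_inseparable (residue_map phi q)]].
Proof.
tfae.
- move=> epi; split; last exact: epi_kaehler_eq0.
  by move=> R' h; apply/epi_spec_inj/epi_base_change.
- move=> [ui Om]; split; first exact: kaehler_eq0_unramified.
  exact: universally_injective_field_monic.
(* Condition (iv) is reached from (iii) by way of (i). *)
- move=> [unr mono]; have epi := unramified_field_monic_epi phi_ft unr mono.
  split=> [||q]; [exact: epi_spec_inj|exact: epi_kaehler_eq0|split=> [_|p _] y].
    exact: epi_residue_map_surj.
  (* The exponent [p ^ 0 = 1] suffices, since the extension is trivial. *)
  by exists 0; apply: epi_residue_map_surj.
(* Condition (iv) yields both halves of (iii), which give (i). *)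
- move=> [inj Om pi]; apply: unramified_field_monic_epi => //.
    exact: kaehler_eq0_unramified.
  exact: purely_inseparable_field_monic.
Qed.
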